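(* If $T$ is a tournament of order $n\geq 5$, then $w(T)\leq n-2$.
   Context: A tournament is an orientation of a finite complete graph; its order is its number of vertices. A set $S$ of vertices is dominating if every vertex is in $S$ or is an out-neighbour of a vertex in $S$. A walk follows the direction of arcs and may repeat vertices and arcs; its length is the number of arcs traversed (counted with repetition); a single vertex is a closed walk of length $0$. A closed dominating walk is a closed walk whose vertex set is dominating, and $w(T)$ (the watchman number) is the minimum length of a closed dominating walk in $T$. Every tournament has a closed dominating walk, so $w(T)$ is well defined. *)

(* Defs.v *)
From mathcomp Require Import all_boot.

Set Implicit Arguments.
Unset Strict Implicit.
Unset Printing Implicit Defensive.

(* The vertex set is nonempty: the empty digraph has no closed walk at all. *)
Record tournament := Tournament {
  vertex :> finType;
  arc : rel vertex;
  vertex_gt0 : 0 < #|vertex|;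
  arc_irrefl : irreflexive arc;
  arc_orient : forall x y : vertex, x != y -> arc x y (+) arc y x
}.

Definition dominating (T : tournament) (S : {set T}) : bool :=
  [forall v, (v \in S) || [exists u in S, arc u v]].

(* The vertex sequence x :: p is a walk from x, with size p arcs.  The       *)
(* predicate cycle is not used, because cycle (@arc T) [:: x] asks for a     *)
(* loop at x, whereas here [:: x] is a closed walk of length 0.              *)
Definition closed_walk (T : tournament) (x : T) (p : seq T) : bool :=
  path (@arc T) x p && (last x p == x).

Definition closed_dominating_walk (T : tournament) (x : T) (p : seq T) : bool :=
  closed_walk x p && dominating [set v in x :: p].

Definition has_cdw (T : tournament) (k : nat) : bool :=
  [exists x : T, exists p : k.-tuple T, closed_dominating_walk x p].

(* A vertex v with the most descendants reaches every vertex; a closed walk  *)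
(* at v through all the ancestors of v is dominating.                        *)
Lemma ex_cdw (T : tournament) : exists k, has_cdw T k.
Proof.
have [v0 _] := card_gt0P (vertex_gt0 T).
pose e := @arc T.
case: (@arg_maxnP T v0 xpredT (fun v => #|connect e v|) isT) => v _ vmax.
have reach u : connect e v u.
  case: (boolP (connect e v u)) => // nvu.
  have neq : v != u by apply: contraNneq nvu => ->.
  have uv : e u v.
    have /= := arc_orient neq; rewrite -/e.
    case vu: (e v u); last by rewrite addFb.
    by rewrite connect1 in nvu.
  have /= := vmax u isT; rewrite leqNgt; case/negP.
  apply/proper_card/properP; split; last by exists u => //; apply: connect0.
  by apply/subsetP=> w; apply: connect_trans; apply: connect1.
have [p wp pP] : exists2 p, closed_walk v p &
    {in enum T, forall u, connect e u v -> u \in v :: p}.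
  elim: (enum T) => [|u s [p /andP[pp /eqP lp] pP]].
    by exists [::]; rewrite /closed_walk /= ?eqxx.
  case: (boolP (connect e u v)) => [/connectP[q qp lq]|nuv]; last first.
    exists p; first by rewrite /closed_walk pp lp eqxx.
    move=> w; rewrite inE => /orP[/eqP->|/pP//].
    by rewrite (negPf nuv).
  have /connectP[r rp lr] := reach u.
  exists (r ++ q ++ p).
    rewrite /closed_walk !cat_path !last_cat -lr -lq lp eqxx andbT.
    by apply/and3P.
  move=> w; rewrite inE => /orP[/eqP-> _|ws /(pP _ ws)].
    by rewrite -cat_cons mem_cat lr mem_last.
  by rewrite !inE !mem_cat => /orP[->//|->]; rewrite !orbT.
exists (size p); apply/existsP; exists v; apply/existsP; exists (in_tuple p).
rewrite /closed_dominating_walk wp /=; apply/forallP=> u.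
rewrite inE; case: (boolP (u \in v :: p)) => //= nu.
apply/existsP; exists v; rewrite !inE eqxx /=.
have neq : v != u by apply: contraNneq nu => <-; rewrite mem_head.
have := arc_orient neq; case uv: (arc u v); last by rewrite addbF.
by case/negP: nu; apply: pP; rewrite ?mem_enum //; apply: connect1.
Qed.

Definition watchman (T : tournament) : nat := ex_minn (ex_cdw T).

(* Main.v *)
Require Import Defs.
From mathcomp Require Import all_boot.

(** Let [v] be a vertex of maximum out-degree, so that every vertex is reached
    from [v] in at most two steps. If a cycle [v, y, z, ...] is not dominating,
    some [b] outside it beats all its vertices; as [v -> w -> b] for some [w],
    necessarily outside the cycle, [v, w, b, z, ...] is a cycle with one more
    vertex. Starting from a triangle through [v], we reach a dominating cycle
    of length at most [n - 2], or a cycle of length [n - 2] missing only two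
    vertices, one of which, [b], is not dominated. Then [b] has in-degree at
    most one, and it dominates by itself or together with its in-neighbour [a]
    in a triangle [b -> x -> a -> b], unless [a] itself beats every vertex. *)

Section Tournament.

Set Implicit Arguments.
Unset Strict Implicit.

Variable T : tournament.
Local Notation arc := (@Defs.arc T).
Implicit Types (b u v w x : T) (p : seq T).

Lemma arc_total u v : u != v -> arc u v || arc v u.
Proof. by move=> /arc_orient; case: (arc u v). Qed.

Lemma arc_asym u v : arc u v -> ~~ arc v u.
Proof.
case: (eqVneq u v) => [->|/arc_orient]; first by rewrite arc_irrefl.
by case: (arc u v); case: (arc v u).
Qed.

Lemma arc_neq u v : arc u v -> u != v.
Proof. by apply: contraTneq => ->; rewrite arc_irrefl. Qed.

Lemma arcNC u v : u != v -> ~~ arc u v -> arc v u.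
Proof. by move=> /arc_total /orP[->|]. Qed.

Lemma watchman_le_size x p : closed_dominating_walk x p -> watchman T <= size p.
Proof.
move=> xp; rewrite /watchman; case: ex_minnP => m _; apply.
by apply/existsP; exists x; apply/existsP; exists (in_tuple p).
Qed.

(** If [u] were out of reach of [v] in two steps, [u] would beat [v] and all out-neighbours of [v],
    against the maximality of the out-degree of [v]. *)
Lemma exists_king :
  exists v, forall u, u != v -> ~~ arc v u -> exists2 w, arc v w & arc w u.
Proof.
have [v0 _] := card_gt0P (vertex_gt0 T).
case: (@arg_maxnP T v0 xpredT (fun v => #|[pred u | arc v u]|) isT) => v _ vmax.
exists v => u uv nvu.
case: (boolP [exists w, arc v w && arc w u]) => [/existsP[w /andP[]]|].
  by exists w.
move=> /existsPn nw; have /= := vmax u isT; rewrite leqNgt; case/negP.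
apply/proper_card/properP; split.
  apply/subsetP=> w; rewrite !inE => vw; have := nw w; rewrite vw /= => nwu.
  by apply: arcNC nwu; apply: contraNneq nvu => <-.
by exists v; rewrite !inE ?arc_irrefl // (arcNC _ nvu) // eq_sym.
Qed.

Lemma dominatingPn (S : {set T}) :
  ~~ dominating S ->
  exists2 b, b \notin S & forall u, u \in S -> ~~ arc u b.
Proof.
rewrite negb_forall => /existsP[b]; rewrite negb_or => /andP[bS /existsPn nb].
by exists b => // u uS; have := nb u; rewrite uS.
Qed.

Lemma watchman_source v : (forall u, ~~ arc u v) -> watchman T = 0.
Proof.
move=> nv; apply/eqP; rewrite -leqn0.
apply: (@watchman_le_size v [::]); rewrite /closed_dominating_walk /closed_walk.
rewrite /= eqxx /=; apply/negPn/negP => /dominatingPn[b].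
rewrite !inE => bv /(_ v); rewrite !inE eqxx => /(_ isT).
by rewrite (arcNC bv (nv b)).
Qed.

Lemma watchman_indegree_le1 b : #|[set u | arc u b]| <= 1 -> watchman T <= 3.
Proof.
move=> deg; case: (boolP [exists a, arc a b]) => [/existsP[a ab]|/existsPn nb];
  last by rewrite (watchman_source nb).
have aP u : arc u b -> u = a.
  by move=> ub; apply: (card_le1_eqP deg); rewrite inE.
case: (boolP [exists x, arc x a]) => [/existsP[x xa]|/existsPn na];
  last by rewrite (watchman_source na).
have bx : arc b x.
  have xb : x != b by apply: contraTneq xa => ->; apply: arc_asym.
  apply: (arcNC xb); apply/negP=> /aP xE.
  by rewrite xE arc_irrefl in xa.
(* Only [a] beats [b], so [b] dominates every vertex but [a], which lies on the triangle. *)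
apply: (@watchman_le_size b [:: x; a; b]).
rewrite /closed_dominating_walk /closed_walk /= bx xa ab eqxx /=.
apply/negPn/negP => /dominatingPn[c]; rewrite !inE !negb_or.
move=> /and4P[cb _ ca _] /(_ b); rewrite !inE eqxx => /(_ isT) nbc.
have cb' : arc c b by apply: arcNC nbc; rewrite eq_sym.
by rewrite (aP _ cb') eqxx in ca.
Qed.

(* A cycle through [v] is stored as a duplicate-free [p] with [last v p = v]:
   the base point [v] occurs in [p] at the end only. *)
Lemma undominated_longer_cycle v p b :
    (forall u, u != v -> ~~ arc v u -> exists2 w, arc v w & arc w u) ->
    closed_walk v p -> uniq p -> 1 < size p ->
    b \notin p -> (forall u, u \in p -> ~~ arc u b) ->
  exists q, [/\ closed_walk v q, uniq q & size q = (size p).+1].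
Proof.
move=> king; case: p => [|y [|z r]] //= /andP[pp /eqP lp] up _ bp nb.
have vp : v \in [:: y, z & r] by rewrite -lp in_cons /= mem_last orbT.
have bv : b != v by apply: contraNneq bp => ->.
have [w vw wb] := king b bv (nb v vp).
have wp : w \notin [:: y, z & r].
  by apply: contraTN wb => /nb.
have bz : arc b z.
  have zp : z \in [:: y, z & r] by rewrite !inE eqxx orbT.
  by apply: (arcNC _ (nb z zp)); apply: contraNneq bp => <-.
have nwb := arc_neq wb.
(* The arcs [v -> y -> z] give way to [v -> w -> b -> z]: [y] leaves, [w] and [b] enter. *)
exists [:: w, b, z & r]; move: pp up wp bp lp => /= /and3P[_ _ pr].
move=> /and3P[_ zr ur]; rewrite !inE !negb_or.
move=> /and3P[_ wz wr] /and3P[_ bz' br] lr.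
split=> //; first by rewrite /closed_walk /= vw wb bz pr lr eqxx.
by rewrite nwb wz wr bz' br zr ur.
Qed.

(** An in-neighbour of [b] is neither [b] nor in [p], which leaves room for at most one vertex. *)
Lemma undominated_indegree_le1 p b :
    uniq p -> #|T| - 2 <= size p -> b \notin p ->
    (forall u, u \in p -> ~~ arc u b) ->
  #|[set u | arc u b]| <= 1.
Proof.
move=> up sp bp nb; have ubp : uniq (b :: p) by rewrite /= bp.
have sub : [set u | arc u b] \subset [predC b :: p].
  apply/subsetP=> u; rewrite !inE => ub; rewrite negb_or (arc_neq ub) /=.
  by apply: contraTN ub => /nb.
apply: leq_trans (subset_leq_card sub) _.
have := cardC (mem (b :: p)); rewrite (card_uniqP ubp) /= => cE.
rewrite -(leq_add2l (size p).+1) cE addn1.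
by move: sp; rewrite leq_subLR addnC addn2.
Qed.

Lemma watchman_le_cycle v p :
    (forall u, u != v -> ~~ arc v u -> exists2 w, arc v w & arc w u) ->
    closed_walk v p -> uniq p -> 2 < size p <= #|T| - 2 ->
  watchman T <= #|T| - 2.
Proof.
(* Induction on the shortfall [d] of the cycle from length [#|T| - 2]; each extension lowers it by
   one. *)
move=> king; move: {-1}(#|T| - 2 - size p) (erefl (#|T| - 2 - size p)) => d.
elim: d p => [|d IHd] p dE wp up /andP[p3 pn];
  (case: (boolP (dominating [set u in v :: p])) => [dom|/dominatingPn[b]];
    first by apply: leq_trans pn; apply: (@watchman_le_size v);
             rewrite /closed_dominating_walk wp);
  rewrite inE in_cons negb_or => /andP[_ bp] nbS;
  have nb u (pu : u \in p) : ~~ arc u b by apply: nbS; rewrite !inE pu orbT.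
(* No shortfall is left, so [b] has in-degree at most one; the resulting bound 3 is at most
   [size p]. *)
- apply: leq_trans (leq_trans p3 pn); apply: (@watchman_indegree_le1 b).
  by apply: (undominated_indegree_le1 up _ bp nb); rewrite -subn_eq0 dE.
- have [q [wq uq sq]] := undominated_longer_cycle king wp up (ltnW p3) bp nb.
  apply: (IHd q) => //; first by rewrite sq subnS dE.
  by rewrite sq ltnS (ltnW p3) -subn_gt0 dE.
Qed.

End Tournament.

Theorem corollary3p11 (T : tournament) (n : nat) (hT : #|T| = n) (hn : 5 <= n) :
  watchman T <= n - 2.
Proof.
rewrite -hT in hn *; have [v king] := exists_king T.
case: (boolP [exists u, Defs.arc u v]) => [/existsP[u uv]|/existsPn nv]; last first.
  by rewrite (watchman_source nv).
have [w vw wu] := king u (arc_neq uv) (arc_asym uv).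
apply: (@watchman_le_cycle _ v [:: w; u; v] king).
- by rewrite /closed_walk /= vw wu uv eqxx.
- by rewrite /= !inE negb_or (arc_neq wu) (arc_neq uv) eq_sym (arc_neq vw).
(* Order at least 5 gives the initial triangle room: [3 <= #|T| - 2]. *)
- by rewrite /= leq_subRL ?(leq_trans _ hn).
Qed.
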